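(* Let $\mathcal{C}$ be an accessible right semi-model category endowed with an accessible algebraic realisation $(L,R)$ of the (trivial cofibration, fibration) weak factorisation system, and let $T$ be the corresponding fibrant replacement monad on $\mathcal{C}$. Equip the category $T\text{-}\mathbf{Alg}$ of $T$-algebras with the transferred accessible weak model structure, in which a map is a fibration (respectively, trivial fibration) if and only if its underlying map in $\mathcal{C}$ is one. Suppose further that path objects lift along the forgetful functor $U : T\text{-}\mathbf{Alg} \to \mathcal{C}$, in the sense that if $(X,\boldsymbol{x})$ is a $T$-algebra, then there exists a path object factorisation $X \to PX \to X \times X$ in $\mathcal{C}$ that lifts along $U$ to a factorisation of the diagonal $(X,\boldsymbol{x}) \to (X,\boldsymbol{x}) \times (X,\boldsymbol{x})$ in $T\text{-}\mathbf{Alg}$. Then $T\text{-}\mathbf{Alg}$ is a Quillen model category.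
   Context: Weak and semi-model categories. A pre-model category is a complete and cocomplete category equipped with two weak factorisation systems, called (cofibration, trivial fibration) and (trivial cofibration, fibration), such that each trivial fibration is a fibration (equivalently, each trivial cofibration is a cofibration). An object $X$ is cofibrant if $\emptyset \to X$ is a cofibration, fibrant if $X \to 1$ is a fibration. A core cofibration is a cofibration between cofibrant objects; a core fibration is a fibration between fibrant objects. A cofibration is acyclic if it has the left lifting property against all core fibrations; a fibration is acyclic if it has the right lifting property against all core cofibrations. A relative cylinder object for a cofibration $A \to B$ is a factorisation $B \coprod_A B \xrightarrow{i} I_A B \to B$ of the codiagonal such that $i$ is a cofibration and the composite of the first coprojection $B \to B\coprod_A B$ with $i$ is an acyclic cofibration. Dually, a relative path object for a fibration $Y \to X$ is a factorisation $Y \to P_X Y \xrightarrow{p} Y\times_X Y$ of the diagonal such that $p$ is a fibration and the composite of $p$ with the first projection $Y \times_X Y \to Y$ is an acyclic fibration. A path object $X \to PX \to X\times X$ for a fibrant object $X$ is a relative path object for $X \to 1$. A weak model category is a pre-model category such that each cofibration $A \to B$ with $A$ cofibrant and $B$ fibrant admits a relative cylinder object, and each fibration $Y \to X$ with $Y$ cofibrant and $X$ fibrant admits a relative path object. A right semi-model category is a pre-model category for which there exists a (necessarily unique) class $W$ of arrows, called weak equivalences, containing the isomorphisms and satisfying 2-out-of-6, such that a core fibration is a trivial fibration if and only if it is in $W$, and a cofibration is a trivial cofibration if and only if it is in $W$. Each right semi-model category is a weak model category. A pre-model category is a Quillen model category if its (trivial) cofibrations and (trivial) fibrations are those of a Quillen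 model structure. Accessibility. A functorial factorisation on $\mathcal{C}$ is a section $(L,E,R) : \mathcal{C}^{\mathbf 2} \to \mathcal{C}^{\mathbf 3}$ of the composition functor, sending $f : X \to Y$ to $X \xrightarrow{Lf} Ef \xrightarrow{Rf} Y$. A weak factorisation system on a locally presentable category is accessible if it admits a functorial factorisation, with $Lf$ and $Rf$ always in the left and right classes, that is an accessible functor. A pre-model (or weak model, or semi-model) category is accessible if its underlying category is locally presentable and both its weak factorisation systems are accessible. Algebraic weak factorisation systems. A functorial factorisation induces endofunctors $L,R$ of $\mathcal{C}^{\mathbf 2}$ with natural transformations $\epsilon : L \to 1$, $\epsilon_f = (1,Rf)$, and $\eta : 1 \to R$, $\eta_f = (Lf,1)$. An algebraic weak factorisation system $(L,R)$ consists of a functorial factorisation together with extensions of $(L,\epsilon)$ to a comonad $(L,\epsilon,\Delta)$ and of $(R,\eta)$ to a monad $(R,\eta,\mu)$ such that the maps $LRf \to RLf$ whose domain component is the codomain component $Ef\to E(Lf)$ of $\Delta_f$ and whose codomain component is the domain component $E(Rf)\to Ef$ of $\mu_f$ form a distributive law. Its underlying weak factorisation system has as left and right classes the retract closures of the maps admitting $L$-coalgebra structure and $R$-algebra structure respectively; $(L,R)$ is called an algebraic realisation of this weak factorisation system, and it is accessible if its functorial factorisation is accessible. Since $\eta$ and $\mu$ have identity codomain components, $R$ restricts to a monad on the slice $\mathcal{C}/1\cong\mathcal{C}$; this monad is the fibrant replacement monad $T$ (so $TX = E(X\to 1)$). The underlying object $X$ of any $T$-algebra $(X,\boldsymbol{x})$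 is fibrant in $\mathcal{C}$, and $U$ preserves products. The transferred accessible weak model structure on $T\text{-}\mathbf{Alg}$ described in the claim always exists. *)

(* Defs.v *)
From Stdlib Require Import ProofIrrelevance FunctionalExtensionality.
From mathcomp Require Import ssreflect ssrfun ssrbool.

Set Implicit Arguments.
Unset Strict Implicit.
Unset Printing Implicit Defensive.

(** [Small] is one fixed universe playing the role of the universe of small
    sets.  Categories are locally small: their objects live in a larger
    universe.  Equality of morphisms is Leibniz equality. *)

Definition Small := Type.

Record Category := {
  Ob :> Type;
  Hom : Ob -> Ob -> Small;
  idm : forall X, Hom X X;
  comp : forall X Y Z, Hom Y Z -> Hom X Y -> Hom X Z;
  comp_idl : forall X Y (f : Hom X Y), comp (idm Y) f = f;
  comp_idr : forall X Y (f : Hom X Y), comp f (idm X) = f;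
  comp_assoc : forall W X Y Z (h : Hom Y Z) (g : Hom X Y) (f : Hom W X),
    comp h (comp g f) = comp (comp h g) f }.

Arguments Hom {c} X Y.
Arguments idm {c} X.
Arguments comp {c X Y Z} g f.
Notation "g ∘ f" := (comp g f) (at level 40, left associativity).

Record Functor (C D : Category) := {
  fob :> C -> D;
  fmap : forall X Y, Hom X Y -> Hom (fob X) (fob Y);
  fmap_id : forall X, fmap (idm X) = idm (fob X);
  fmap_comp : forall X Y Z (g : Hom Y Z) (f : Hom X Y),
    fmap (g ∘ f) = fmap g ∘ fmap f }.

Arguments fmap {C D} F {X Y} f : rename.

Definition functor_comp (C D E : Category) (G : Functor D E) (F : Functor C D) :
  Functor C E.
Proof.
refine {| fob X := G (F X); fmap X Y f := fmap G (fmap F f) |}.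
- by move=> X; rewrite !fmap_id.
- by move=> X Y Z g f; rewrite !fmap_comp.
Defined.

Definition is_natural (C D : Category) (F G : Functor C D)
    (a : forall X, Hom (F X) (G X)) : Prop :=
  forall X Y (f : Hom X Y), a Y ∘ fmap F f = fmap G f ∘ a X.

Definition is_iso (C : Category) (X Y : C) (f : Hom X Y) : Prop :=
  exists g : Hom Y X, g ∘ f = idm X /\ f ∘ g = idm Y.

Definition is_retract (C : Category) (X Y : C) : Prop :=
  exists (s : Hom X Y) (r : Hom Y X), r ∘ s = idm X.

(** The objects are the image of a small set; hom-sets are always small. *)
Definition small_category (J : Category) : Prop :=
  exists (S : Small) (e : S -> J), forall j, exists s, e s = j.

Definition is_cone (J C : Category) (F : Functor J C) (c : C)
    (leg : forall j, Hom c (F j)) : Prop :=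
  forall i j (u : Hom i j), fmap F u ∘ leg i = leg j.

Definition is_limit (J C : Category) (F : Functor J C) (c : C)
    (leg : forall j, Hom c (F j)) : Prop :=
  is_cone leg /\
  forall d (m : forall j, Hom d (F j)), is_cone m ->
    exists! h : Hom d c, forall j, leg j ∘ h = m j.

Definition is_cocone (J C : Category) (F : Functor J C) (c : C)
    (leg : forall j, Hom (F j) c) : Prop :=
  forall i j (u : Hom i j), leg j ∘ fmap F u = leg i.

Definition is_colimit (J C : Category) (F : Functor J C) (c : C)
    (leg : forall j, Hom (F j) c) : Prop :=
  is_cocone leg /\
  forall d (m : forall j, Hom (F j) d), is_cocone m ->
    exists! h : Hom c d, forall j, h ∘ leg j = m j.

Definition complete (C : Category) : Prop :=
  forall (J : Category) (F : Functor J C), small_category J ->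
    exists c (leg : forall j, Hom c (F j)), is_limit leg.

Definition cocomplete (C : Category) : Prop :=
  forall (J : Category) (F : Functor J C), small_category J ->
    exists c (leg : forall j, Hom (F j) c), is_colimit leg.

Record Terminal (C : Category) := {
  terminal :> C;
  bang : forall X : C, Hom X terminal;
  bang_unique : forall (X : C) (f g : Hom X terminal), f = g }.

Record Initial (C : Category) := {
  initial :> C;
  cobang : forall X : C, Hom initial X;
  cobang_unique : forall (X : C) (f g : Hom initial X), f = g }.

Arguments bang {C} one X : rename.
Arguments cobang {C} zero X : rename.

Definition is_product (C : Category) (X Y P : C)
    (p1 : Hom P X) (p2 : Hom P Y) : Prop :=
  forall Z (f : Hom Z X) (g : Hom Z Y),
    exists! h : Hom Z P, p1 ∘ h = f /\ p2 ∘ h = g.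

Definition is_pullback (C : Category) (X Y Z P : C) (f : Hom X Z) (g : Hom Y Z)
    (p1 : Hom P X) (p2 : Hom P Y) : Prop :=
  f ∘ p1 = g ∘ p2 /\
  forall W (a : Hom W X) (b : Hom W Y), f ∘ a = g ∘ b ->
    exists! h : Hom W P, p1 ∘ h = a /\ p2 ∘ h = b.

Definition is_pushout (C : Category) (X Y Z P : C) (f : Hom Z X) (g : Hom Z Y)
    (i1 : Hom X P) (i2 : Hom Y P) : Prop :=
  i1 ∘ f = i2 ∘ g /\
  forall W (a : Hom X W) (b : Hom Y W), a ∘ f = b ∘ g ->
    exists! h : Hom P W, h ∘ i1 = a /\ h ∘ i2 = b.

(** A cardinal is represented by a small set [K] having that cardinality. *)

Definition embeds (X Y : Small) : Prop := exists f : X -> Y, injective f.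

Definition card_lt (X K : Small) : Prop := embeds X K /\ ~ embeds K X.

Definition regular_cardinal (K : Small) : Prop :=
  embeds nat K /\
  forall (I : Small) (X : I -> Small),
    card_lt I K -> (forall i, card_lt (X i) K) -> card_lt {i : I & X i} K.

(** A small poset, seen as a category, in which every family of fewer than [K]
    elements has an upper bound. *)
Definition directed_poset (K : Small) (J : Category) : Prop :=
  small_category J /\
  (forall (i j : J) (u v : Hom i j), u = v) /\
  (forall (i j : J), Hom i j -> Hom j i -> i = j) /\
  (forall (S : Small) (x : S -> J), card_lt S K ->
     exists j, forall s, inhabited (Hom (x s) j)).

Definition preserves_directed_colimits (K : Small) (C D : Category)
    (F : Functor C D) : Prop :=
  forall (J : Category) (G : Functor J C) (c : C) (leg : forall j, Hom (G j) c),
    directed_poset K J -> is_colimit leg ->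
    @is_colimit J D (functor_comp F G) (F c) (fun j => fmap F (leg j)).

Definition SetCat : Category :=
  {| Ob := Small; Hom X Y := X -> Y; idm X := fun x => x;
     comp X Y Z g f := fun x => g (f x);
     comp_idl X Y f := erefl; comp_idr X Y f := erefl;
     comp_assoc W X Y Z h g f := erefl |}.

Definition hom_functor (C : Category) (A : C) : Functor C SetCat.
Proof.
refine (@Build_Functor C SetCat (fun X => Hom A X)
          (fun X Y f => fun h : Hom A X => f ∘ h) _ _).
- by move=> X; apply: functional_extensionality => h /=; rewrite comp_idl.
- by move=> X Y Z g f; apply: functional_extensionality => h /=; rewrite comp_assoc.
Defined.

Definition presentable (K : Small) (C : Category) (A : C) : Prop :=
  preserves_directed_colimits K (hom_functor A).

Definition locally_presentable (C : Category) : Prop :=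
  cocomplete C /\
  exists K : Small, regular_cardinal K /\
  exists (S : Small) (g : S -> C),
    (forall s, presentable K (g s)) /\
    forall X : C, exists (J : Category) (D : Functor J C)
      (leg : forall j, Hom (D j) X),
      directed_poset K J /\ (forall j, exists s, D j = g s) /\ is_colimit leg.

(** Accessibility of a functor; only used between locally presentable
    categories, where it needs no further condition relating [K] to the
    categories. *)
Definition accessible_functor (C D : Category) (F : Functor C D) : Prop :=
  exists K : Small, regular_cardinal K /\ preserves_directed_colimits K F.

Record Arrow (C : Category) := Arr {
  dom : C; cod : C; arr :> Hom dom cod }.

Arguments Arr {C dom cod} arr.

Record Square (C : Category) (f g : Arrow C) : Small := Sq {
  sq_dom : Hom (dom f) (dom g);
  sq_cod : Hom (cod f) (cod g);
  sq_comm : arr g ∘ sq_dom = sq_cod ∘ arr f }.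

Lemma square_eq (C : Category) (f g : Arrow C) (s t : Square f g) :
  sq_dom s = sq_dom t -> sq_cod s = sq_cod t -> s = t.
Proof.
case: s t => [a b e] [a' b' e'] /= ha hb; subst a' b'.
by rewrite (proof_irrelevance _ e e').
Qed.

Definition ArrowCat (C : Category) : Category.
Proof.
refine {| Ob := Arrow C; Hom := @Square C;
          idm f := @Sq C f f (idm _) (idm _) _;
          comp f g h t s :=
            @Sq C f h (sq_dom t ∘ sq_dom s) (sq_cod t ∘ sq_cod s) _ |}.
- by move=> X Y f; apply: square_eq; rewrite /= comp_idl.
- by move=> X Y f; apply: square_eq; rewrite /= comp_idr.
- by move=> W X Y Z h g f; apply: square_eq; rewrite /= comp_assoc.
Unshelve.
- by rewrite comp_idl comp_idr.
- by rewrite comp_assoc sq_comm -comp_assoc sq_comm comp_assoc.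
Defined.

Record Pair (C : Category) := {
  pr_dom : C; pr_mid : C; pr_cod : C;
  pr_fst : Hom pr_dom pr_mid; pr_snd : Hom pr_mid pr_cod }.

Record PairHom (C : Category) (p q : Pair C) : Small := {
  ph_dom : Hom (pr_dom p) (pr_dom q);
  ph_mid : Hom (pr_mid p) (pr_mid q);
  ph_cod : Hom (pr_cod p) (pr_cod q);
  ph_fst : pr_fst q ∘ ph_dom = ph_mid ∘ pr_fst p;
  ph_snd : pr_snd q ∘ ph_mid = ph_cod ∘ pr_snd p }.

Lemma pair_hom_eq (C : Category) (p q : Pair C) (s t : PairHom p q) :
  ph_dom s = ph_dom t -> ph_mid s = ph_mid t -> ph_cod s = ph_cod t -> s = t.
Proof.
case: s t => [a b c e1 e2] [a' b' c' e1' e2'] /= ha hb hc; subst a' b' c'.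
by rewrite (proof_irrelevance _ e1 e1') (proof_irrelevance _ e2 e2').
Qed.

Definition PairCat (C : Category) : Category.
Proof.
refine {| Ob := Pair C; Hom := @PairHom C;
          idm p := @Build_PairHom C p p (idm _) (idm _) (idm _) _ _;
          comp p q r t s :=
            @Build_PairHom C p r (ph_dom t ∘ ph_dom s) (ph_mid t ∘ ph_mid s)
              (ph_cod t ∘ ph_cod s) _ _ |}.
- by move=> X Y f; apply: pair_hom_eq; rewrite /= comp_idl.
- by move=> X Y f; apply: pair_hom_eq; rewrite /= comp_idr.
- by move=> W X Y Z h g f; apply: pair_hom_eq; rewrite /= comp_assoc.
Unshelve.
- by rewrite comp_idl comp_idr.
- by rewrite comp_idl comp_idr.
- by rewrite comp_assoc ph_fst -comp_assoc ph_fst comp_assoc.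
- by rewrite comp_assoc ph_snd -comp_assoc ph_snd comp_assoc.
Defined.

(** A strict section of the composition functor [PairCat C -> ArrowCat C],
    given by its components; [ff_functor] is the section itself. *)

Record FunctorialFactorisation (C : Category) := {
  ff_E : Arrow C -> C;
  ff_L : forall f : Arrow C, Hom (dom f) (ff_E f);
  ff_R : forall f : Arrow C, Hom (ff_E f) (cod f);
  ff_fac : forall f : Arrow C, ff_R f ∘ ff_L f = arr f;
  ff_map : forall f g : Arrow C, Square f g -> Hom (ff_E f) (ff_E g);
  ff_map_id : forall f : ArrowCat C, ff_map (idm f) = idm (ff_E f);
  ff_map_comp : forall (f g h : ArrowCat C) (t : Hom g h) (s : Hom f g),
    ff_map (t ∘ s) = ff_map t ∘ ff_map s;
  ff_natL : forall (f g : Arrow C) (s : Square f g),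
    ff_L g ∘ sq_dom s = ff_map s ∘ ff_L f;
  ff_natR : forall (f g : Arrow C) (s : Square f g),
    ff_R g ∘ ff_map s = sq_cod s ∘ ff_R f }.

Arguments ff_map {C} F {f g} s : rename.

Section FactorisationFunctors.
Variables (C : Category) (F : FunctorialFactorisation C).

Definition ff_functor : Functor (ArrowCat C) (PairCat C).
Proof.
refine (@Build_Functor (ArrowCat C) (PairCat C)
  (fun f => {| pr_fst := ff_L F f; pr_snd := ff_R F f |})
  (fun f g s => @Build_PairHom C
     {| pr_fst := ff_L F f; pr_snd := ff_R F f |}
     {| pr_fst := ff_L F g; pr_snd := ff_R F g |}
     (sq_dom s) (ff_map F s) (sq_cod s) (ff_natL F s) (ff_natR F s)) _ _).
- by move=> f; apply: pair_hom_eq => //=; rewrite ff_map_id.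
- by move=> f g h t s; apply: pair_hom_eq => //=; rewrite ff_map_comp.
Defined.

Definition Lfun : Functor (ArrowCat C) (ArrowCat C).
Proof.
refine (@Build_Functor (ArrowCat C) (ArrowCat C) (fun f => Arr (ff_L F f))
  (fun f g s => @Sq C (Arr (ff_L F f)) (Arr (ff_L F g))
                  (sq_dom s) (ff_map F s) (ff_natL F s)) _ _).
- by move=> f; apply: square_eq => //=; rewrite ff_map_id.
- by move=> f g h t s; apply: square_eq => //=; rewrite ff_map_comp.
Defined.

Definition Rfun : Functor (ArrowCat C) (ArrowCat C).
Proof.
refine (@Build_Functor (ArrowCat C) (ArrowCat C) (fun f => Arr (ff_R F f))
  (fun f g s => @Sq C (Arr (ff_R F f)) (Arr (ff_R F g))
                  (ff_map F s) (sq_cod s) (ff_natR F s)) _ _).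
- by move=> f; apply: square_eq => //=; rewrite ff_map_id.
- by move=> f g h t s; apply: square_eq => //=; rewrite ff_map_comp.
Defined.

Definition Lcounit (f : ArrowCat C) : Hom (Lfun f) f.
Proof.
refine (@Sq C (Lfun f) f (idm _) (ff_R F f) _).
by rewrite comp_idr /= ff_fac.
Defined.

Definition Runit (f : ArrowCat C) : Hom f (Rfun f).
Proof.
refine (@Sq C f (Rfun f) (ff_L F f) (idm _) _).
by rewrite comp_idl /= ff_fac.
Defined.

End FactorisationFunctors.

Arguments Lcounit {C} F f.
Arguments Runit {C} F f.

Record is_monad (C : Category) (T : Functor C C)
    (eta : forall X, Hom X (T X)) (mu : forall X, Hom (T (T X)) (T X)) : Prop := {
  monad_unit_nat : forall X Y (f : Hom X Y), eta Y ∘ f = fmap T f ∘ eta X;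
  monad_mult_nat : forall X Y (f : Hom X Y),
    mu Y ∘ fmap T (fmap T f) = fmap T f ∘ mu X;
  monad_unitl : forall X, mu X ∘ eta (T X) = idm (T X);
  monad_unitr : forall X, mu X ∘ fmap T (eta X) = idm (T X);
  monad_assoc : forall X, mu X ∘ mu (T X) = mu X ∘ fmap T (mu X) }.

Record is_comonad (C : Category) (G : Functor C C)
    (eps : forall X, Hom (G X) X) (dlt : forall X, Hom (G X) (G (G X))) : Prop := {
  comonad_counit_nat : forall X Y (f : Hom X Y), eps Y ∘ fmap G f = f ∘ eps X;
  comonad_comult_nat : forall X Y (f : Hom X Y),
    dlt Y ∘ fmap G f = fmap G (fmap G f) ∘ dlt X;
  comonad_counitl : forall X, eps (G X) ∘ dlt X = idm (G X);
  comonad_counitr : forall X, fmap G (eps X) ∘ dlt X = idm (G X);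
  comonad_coassoc : forall X, dlt (G X) ∘ dlt X = fmap G (dlt X) ∘ dlt X }.

Definition is_algebra (C : Category) (T : Functor C C)
    (eta : forall X, Hom X (T X)) (mu : forall X, Hom (T (T X)) (T X))
    (X : C) (x : Hom (T X) X) : Prop :=
  x ∘ eta X = idm X /\ x ∘ mu X = x ∘ fmap T x.

Definition is_coalgebra (C : Category) (G : Functor C C)
    (eps : forall X, Hom (G X) X) (dlt : forall X, Hom (G X) (G (G X)))
    (X : C) (x : Hom X (G X)) : Prop :=
  eps X ∘ x = idm X /\ dlt X ∘ x = fmap G x ∘ x.

(** Distributive law [G T -> T G] of a comonad [G] over a monad [T]. *)
Record is_distributive_law (C : Category)
    (G : Functor C C) (eps : forall X, Hom (G X) X)
    (dlt : forall X, Hom (G X) (G (G X)))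
    (T : Functor C C) (eta : forall X, Hom X (T X))
    (mu : forall X, Hom (T (T X)) (T X))
    (lam : forall X, Hom (G (T X)) (T (G X))) : Prop := {
  dist_nat : @is_natural C C (functor_comp G T) (functor_comp T G) lam;
  dist_unit : forall X, lam X ∘ fmap G (eta X) = eta (G X);
  dist_mult : forall X,
    lam X ∘ fmap G (mu X) = mu (G X) ∘ fmap T (lam X) ∘ lam (T X);
  dist_counit : forall X, fmap T (eps X) ∘ lam X = eps (T X);
  dist_comult : forall X,
    fmap T (dlt X) ∘ lam X = lam (G X) ∘ fmap G (lam X) ∘ dlt (T X) }.

Record Monad (C : Category) := {
  mfun :> Functor C C;
  munit : forall X, Hom X (mfun X);
  mmult : forall X, Hom (mfun (mfun X)) (mfun X);
  mlaws : is_monad munit mmult }.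

Section Algebras.
Variables (C : Category) (T : Monad C).

Record Algebra := {
  alg_ob : C;
  alg_act : Hom (T alg_ob) alg_ob;
  alg_laws : is_algebra (@munit C T) (@mmult C T) alg_act }.

Record AlgHom (X Y : Algebra) : Small := {
  alg_map : Hom (alg_ob X) (alg_ob Y);
  alg_comm : alg_map ∘ alg_act X = alg_act Y ∘ fmap T alg_map }.

Lemma alg_hom_eq (X Y : Algebra) (f g : AlgHom X Y) :
  alg_map f = alg_map g -> f = g.
Proof.
case: f g => [f e] [g e'] /= h; subst g.
by rewrite (proof_irrelevance _ e e').
Qed.

Definition AlgCat : Category.
Proof.
refine {| Ob := Algebra; Hom := AlgHom;
          idm X := @Build_AlgHom X X (idm _) _;
          comp X Y Z g f := @Build_AlgHom X Z (alg_map g ∘ alg_map f) _ |}.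
- by move=> X Y f; apply: alg_hom_eq; rewrite /= comp_idl.
- by move=> X Y f; apply: alg_hom_eq; rewrite /= comp_idr.
- by move=> W X Y Z h g f; apply: alg_hom_eq; rewrite /= comp_assoc.
Unshelve.
- by rewrite fmap_id comp_idl comp_idr.
- by rewrite -comp_assoc alg_comm comp_assoc alg_comm fmap_comp comp_assoc.
Defined.

Definition forget : Functor AlgCat C :=
  @Build_Functor AlgCat C alg_ob alg_map
    (fun X => erefl) (fun X Y Z g f => erefl).

End Algebras.

(** The square [L R f -> R L f] with components those of [Delta] and [mu]; both
    of its sides are identities by the (co)unit laws. *)
Definition awfs_square (C : Category) (F : FunctorialFactorisation C)
    (Delta : forall f, Hom (Lfun F f) (Lfun F (Lfun F f)))
    (mu : forall f, Hom (Rfun F (Rfun F f)) (Rfun F f))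
    (hD : is_comonad (Lcounit F) Delta) (hM : is_monad (Runit F) mu)
    (f : ArrowCat C) : Hom (Lfun F (Rfun F f)) (Rfun F (Lfun F f)).
Proof.
refine (@Sq C (Lfun F (Rfun F f)) (Rfun F (Lfun F f))
          (sq_cod (Delta f)) (sq_dom (mu f)) _).
have /= -> := f_equal (@sq_cod _ _ _) (comonad_counitl hD f).
by have /= -> := f_equal (@sq_dom _ _ _) (monad_unitl hM f).
Defined.

Record AWFS (C : Category) := {
  awfs_ff :> FunctorialFactorisation C;
  awfs_Delta : forall f, Hom (Lfun awfs_ff f) (Lfun awfs_ff (Lfun awfs_ff f));
  awfs_mu : forall f, Hom (Rfun awfs_ff (Rfun awfs_ff f)) (Rfun awfs_ff f);
  awfs_comonad : is_comonad (Lcounit awfs_ff) awfs_Delta;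
  awfs_monad : is_monad (Runit awfs_ff) awfs_mu;
  awfs_dist : is_distributive_law
    (Lcounit awfs_ff) awfs_Delta (Runit awfs_ff) awfs_mu
    (awfs_square awfs_comonad awfs_monad) }.

Definition accessible_awfs (C : Category) (A : AWFS C) : Prop :=
  accessible_functor (ff_functor A).

Definition awfs_left (C : Category) (A : AWFS C) (f : ArrowCat C) : Prop :=
  exists g : ArrowCat C, is_retract f g /\
    exists s, is_coalgebra (Lcounit A) (@awfs_Delta C A) (X := g) s.

Definition awfs_right (C : Category) (A : AWFS C) (f : ArrowCat C) : Prop :=
  exists g : ArrowCat C, is_retract f g /\
    exists s, is_algebra (Runit A) (@awfs_mu C A) (X := g) s.

(** The fibrant replacement monad: the restriction of [R] to the slice over the
    terminal object, transported to the base.  The iterate [T (T X)] is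
    [E (bang (T X))], identified with [E (R (bang X))] by the canonical
    isomorphism [ff_map (bang_square X)]. *)
Section FibrantReplacement.
Variables (C : Category) (one : Terminal C) (A : AWFS C).

Definition to_one (X : C) : ArrowCat C := Arr (bang one X).

Definition to_one_map (X Y : C) (f : Hom X Y) : Hom (to_one X) (to_one Y) :=
  @Sq C (to_one X) (to_one Y) f (idm _) (bang_unique _ _).

Definition bang_square (X : C) : Hom (to_one (ff_E A (to_one X))) (Rfun A (to_one X)) :=
  @Sq C (to_one (ff_E A (to_one X))) (Rfun A (to_one X))
    (idm _) (idm _) (bang_unique _ _).

Definition fib_functor : Functor C C.
Proof.
refine (@Build_Functor C C (fun X => ff_E A (to_one X))
          (fun X Y f => ff_map A (to_one_map f)) _ _).
- by move=> X; rewrite -(ff_map_id A (to_one X)); congr ff_map; apply: square_eq.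
- move=> X Y Z g f; rewrite -ff_map_comp; congr ff_map.
  by apply: square_eq => //=; rewrite comp_idl.
Defined.

Definition fib_unit (X : C) : Hom X (fib_functor X) := ff_L A (to_one X).

Definition fib_mult (X : C) : Hom (fib_functor (fib_functor X)) (fib_functor X) :=
  sq_dom (@awfs_mu C A (to_one X)) ∘ ff_map A (bang_square X).

Lemma fib_laws : is_monad fib_unit fib_mult.
Proof.
have hM := awfs_monad A.
split.
- by move=> X Y f; exact: (ff_natL A (to_one_map f)).
- move=> X Y f; rewrite /fib_mult /=.
  have /= e := f_equal (@sq_dom _ _ _) (monad_mult_nat hM (to_one_map f)).
  rewrite comp_assoc -e -!comp_assoc; congr comp.
  rewrite -!(@ff_map_comp C A (to_one _)).
  by congr ff_map; apply: square_eq => /=; rewrite !comp_idl ?comp_idr.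
- move=> X; rewrite /fib_mult /fib_unit /= -comp_assoc -(ff_natL A (bang_square X)).
  have /= e := f_equal (@sq_dom _ _ _) (monad_unitl hM (to_one X)).
  by rewrite comp_idr.
- move=> X; rewrite /fib_mult /= -comp_assoc -(@ff_map_comp C A (to_one _)).
  apply: etrans (f_equal (@sq_dom _ _ _) (monad_unitr hM (to_one X))) => /=.
  by congr comp; congr ff_map; apply: square_eq => /=; rewrite comp_idl.
- move=> X; rewrite /fib_mult /=.
  have /= e := f_equal (@sq_dom _ _ _) (monad_assoc hM (to_one X)).
  have /= n := f_equal (@sq_dom _ _ _) (monad_mult_nat hM (bang_square X)).
  rewrite -[LHS]comp_assoc [X in _ ∘ X = _]comp_assoc -[X in _ ∘ (X ∘ _) = _]n.
  rewrite !comp_assoc [X in X ∘ _ ∘ _ = _]e -!comp_assoc.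
  congr comp; rewrite -(@ff_map_comp C A (to_one _)).
  apply: (etrans (esym (@ff_map_comp C A _ _ _ (@awfs_mu C A (to_one X))
    (fmap (Rfun A) (bang_square X) ∘ bang_square _)))).
  rewrite -[RHS](@ff_map_comp C A (to_one _)).
  congr ff_map; apply: square_eq => /=; last exact: bang_unique.
  by rewrite comp_idl comp_idr.
Qed.

Definition fibrant_replacement_monad : Monad C := {| mlaws := fib_laws |}.

End FibrantReplacement.

Definition MorphismClass (C : Category) := forall X Y : C, Hom X Y -> Prop.

Definition lifts (C : Category) (A B X Y : C) (i : Hom A B) (p : Hom X Y) : Prop :=
  forall (u : Hom A X) (v : Hom B Y), p ∘ u = v ∘ i ->
    exists d : Hom B X, d ∘ i = u /\ p ∘ d = v.

Record is_wfs (C : Category) (Lc Rc : MorphismClass C) : Prop := {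
  wfs_left : forall (A B : C) (i : Hom A B),
    Lc A B i <-> (forall (X Y : C) (p : Hom X Y), Rc X Y p -> lifts i p);
  wfs_right : forall (X Y : C) (p : Hom X Y),
    Rc X Y p <-> (forall (A B : C) (i : Hom A B), Lc A B i -> lifts i p);
  wfs_fact : forall (X Y : C) (f : Hom X Y),
    exists (Z : C) (i : Hom X Z) (p : Hom Z Y),
      Lc X Z i /\ Rc Z Y p /\ p ∘ i = f }.

Definition accessible_wfs (C : Category) (Lc Rc : MorphismClass C) : Prop :=
  exists F : FunctorialFactorisation C,
    (forall f : Arrow C, Lc _ _ (ff_L F f) /\ Rc _ _ (ff_R F f)) /\
    accessible_functor (ff_functor F).

Definition algebraic_realisation (C : Category) (A : AWFS C)
    (Lc Rc : MorphismClass C) : Prop :=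
  (forall (X Y : C) (f : Hom X Y), Lc X Y f <-> awfs_left A (Arr f)) /\
  (forall (X Y : C) (f : Hom X Y), Rc X Y f <-> awfs_right A (Arr f)).

Record PreModel (C : Category) := {
  cof : MorphismClass C;
  tfib : MorphismClass C;
  tcof : MorphismClass C;
  fib : MorphismClass C;
  pm_complete : complete C;
  pm_cocomplete : cocomplete C;
  pm_wfs_cof : is_wfs cof tfib;
  pm_wfs_fib : is_wfs tcof fib;
  pm_tfib_fib : forall (X Y : C) (f : Hom X Y), tfib f -> fib f }.

Arguments cof {C} M {X Y} f : rename.
Arguments tfib {C} M {X Y} f : rename.
Arguments tcof {C} M {X Y} f : rename.
Arguments fib {C} M {X Y} f : rename.

Definition accessible_premodel (C : Category) (M : PreModel C) : Prop :=
  locally_presentable C /\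
  accessible_wfs (@cof C M) (@tfib C M) /\ accessible_wfs (@tcof C M) (@fib C M).

Section ModelNotions.
Variables (C : Category) (M : PreModel C).

(** Both conditions are independent of the chosen initial or terminal object, the
    classes of a weak factorisation system being closed under isomorphism. *)
Definition cofibrant (X : C) : Prop := exists zero : Initial C, cof M (cobang zero X).
Definition fibrant (X : C) : Prop := exists one : Terminal C, fib M (bang one X).

Definition core_cof (A B : C) (i : Hom A B) : Prop :=
  cof M i /\ cofibrant A /\ cofibrant B.
Definition core_fib (X Y : C) (p : Hom X Y) : Prop :=
  fib M p /\ fibrant X /\ fibrant Y.

Definition acyclic_cof (A B : C) (i : Hom A B) : Prop :=
  cof M i /\ forall (X Y : C) (p : Hom X Y), core_fib p -> lifts i p.
Definition acyclic_fib (X Y : C) (p : Hom X Y) : Prop :=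
  fib M p /\ forall (A B : C) (i : Hom A B), core_cof i -> lifts i p.

(** [Q], with coprojections [i1] and [i2], is the pushout of [f] along itself;
    [q ∘ i] is the codiagonal. *)
Definition is_relative_cylinder (A B Q I : C) (f : Hom A B)
    (i1 i2 : Hom B Q) (i : Hom Q I) (q : Hom I B) : Prop :=
  is_pushout f f i1 i2 /\
  q ∘ i ∘ i1 = idm B /\ q ∘ i ∘ i2 = idm B /\
  cof M i /\ acyclic_cof (i ∘ i1).

(** [Q], with projections [p1] and [p2], is the pullback of [f] along itself;
    [p ∘ d] is the diagonal. *)
Definition is_relative_path_object (X Y Q P : C) (f : Hom Y X)
    (p1 p2 : Hom Q Y) (d : Hom Y P) (p : Hom P Q) : Prop :=
  is_pullback f f p1 p2 /\
  p1 ∘ (p ∘ d) = idm Y /\ p2 ∘ (p ∘ d) = idm Y /\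
  fib M p /\ acyclic_fib (p1 ∘ p).

Definition weak_model : Prop :=
  (forall (A B : C) (f : Hom A B), cof M f -> cofibrant A -> fibrant B ->
     exists Q I (i1 i2 : Hom B Q) (i : Hom Q I) (q : Hom I B),
       is_relative_cylinder f i1 i2 i q) /\
  (forall (Y X : C) (f : Hom Y X), fib M f -> cofibrant Y -> fibrant X ->
     exists Q P (p1 p2 : Hom Q Y) (d : Hom Y P) (p : Hom P Q),
       is_relative_path_object f p1 p2 d p).

Definition two_of_six (W : MorphismClass C) : Prop :=
  forall (X Y Z V : C) (f : Hom X Y) (g : Hom Y Z) (h : Hom Z V),
    W _ _ (g ∘ f) -> W _ _ (h ∘ g) ->
    W _ _ f /\ W _ _ g /\ W _ _ h /\ W _ _ (h ∘ g ∘ f).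

Definition right_semi_model : Prop :=
  exists W : MorphismClass C,
    (forall (X Y : C) (f : Hom X Y), is_iso f -> W _ _ f) /\
    two_of_six W /\
    (forall (X Y : C) (f : Hom X Y), core_fib f -> (tfib M f <-> W _ _ f)) /\
    (forall (X Y : C) (f : Hom X Y), cof M f -> (tcof M f <-> W _ _ f)).

Definition two_of_three (W : MorphismClass C) : Prop :=
  forall (X Y Z : C) (f : Hom X Y) (g : Hom Y Z),
    (W _ _ f -> W _ _ g -> W _ _ (g ∘ f)) /\
    (W _ _ f -> W _ _ (g ∘ f) -> W _ _ g) /\
    (W _ _ g -> W _ _ (g ∘ f) -> W _ _ f).

End ModelNotions.

(** A Quillen model structure on a category (whose limits and colimits are
    required separately), presented by weak factorisation systems; closure of
    the three classes under retracts is then automatic. *)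
Definition is_model_structure (C : Category) (W Cof Fib : MorphismClass C) : Prop :=
  two_of_three W /\
  is_wfs (fun X Y f => Cof X Y f /\ W X Y f) Fib /\
  is_wfs Cof (fun X Y f => Fib X Y f /\ W X Y f).

Definition quillen_model (C : Category) (M : PreModel C) : Prop :=
  exists W : MorphismClass C,
    is_model_structure W (@cof C M) (@fib C M) /\
    (forall (X Y : C) (f : Hom X Y), tcof M f <-> cof M f /\ W X Y f) /\
    (forall (X Y : C) (f : Hom X Y), tfib M f <-> fib M f /\ W X Y f).

Section Transfer.
Variables (C : Category) (M : PreModel C) (T : Monad C).

Definition transferred (N : PreModel (AlgCat T)) : Prop :=
  (forall (X Y : AlgCat T) (f : Hom X Y), fib N f <-> fib M (fmap (forget T) f)) /\
  (forall (X Y : AlgCat T) (f : Hom X Y), tfib N f <-> tfib M (fmap (forget T) f)).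

(** The factorisation [X -> P -> Q] of the diagonal takes place among algebras,
    with [Q] a product [X * X] there, and its image under the forgetful functor
    is a path object, that is a relative path object for [X -> 1]. *)
Definition path_objects_lift (one : Terminal C) : Prop :=
  forall X : AlgCat T,
    exists (Q P : AlgCat T) (p1 p2 : Hom Q X) (d : Hom X P) (p : Hom P Q),
      is_product p1 p2 /\
      p1 ∘ (p ∘ d) = idm X /\ p2 ∘ (p ∘ d) = idm X /\
      is_relative_path_object M (bang one (forget T X))
        (fmap (forget T) p1) (fmap (forget T) p2)
        (fmap (forget T) d) (fmap (forget T) p).

End Transfer.

(* Main.v *)
From Stdlib Require Import ClassicalEpsilon.
From mathcomp Require Import ssreflect ssrfun ssrbool.
Require Import Defs.

Set Implicit Arguments.
Unset Strict Implicit.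
Unset Printing Implicit Defensive.

(** Let [W] be the class of weak equivalences of the right semi-model category.
    The weak equivalences of algebras are the maps that the forgetful functor
    sends into [W].

    Every algebra has a fibrant underlying object, because its structure map
    exhibits it as a retract of a value of the fibrant replacement monad
    ([algebra_fibrant]).  So every fibration of algebras lies over a core
    fibration, and the defining property of [W] says that the trivial fibrations
    of algebras are the fibrations that are weak equivalences
    ([transferred_tfib_iff]).

    The matching statement for trivial cofibrations uses Quillen's path object
    argument.  A trivial cofibration of algebras [f : X -> Y] has a retraction
    [r], since [X] is fibrant, and lifting [f] against the path object of [Y]
    gives a homotopy from the identity of [Y] to [f ∘ r].  The legs of that path
    object are in [W] ([acyclic_core_fib_weq]), so [f ∘ r] is in [W]; as
    [r ∘ f] is an identity, 2-out-of-6 puts [f] in [W].  Conversely, a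
    cofibration in [W] is a retract of the trivial cofibration that it factors
    through, because the fibration of this factorisation is then trivial. *)

(** * Weak factorisation systems *)

Section WeakFactorisation.
Context (C : Category) (Lc Rc : MorphismClass C) (hw : is_wfs Lc Rc).

Lemma wfs_lifts (A B X Y : C) (i : Hom A B) (p : Hom X Y) :
  Lc i -> Rc p -> lifts i p.
Proof. by move=> hi; apply: (proj1 (wfs_left hw i) hi). Qed.

Lemma wfs_right_comp (X Y Z : C) (p : Hom X Y) (q : Hom Y Z) :
  Rc p -> Rc q -> Rc (q ∘ p).
Proof.
move=> hp hq; apply/(wfs_right hw) => A B i hi u v e.
have [|d [d1 d2]] := wfs_lifts hi hq (u := p ∘ u) (v := v).
  by rewrite comp_assoc.
have [|k [k1 k2]] := wfs_lifts hi hp (u := u) (v := d); first by rewrite d1.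
by exists k; rewrite -comp_assoc k2.
Qed.

Lemma wfs_left_comp (X Y Z : C) (i : Hom X Y) (j : Hom Y Z) :
  Lc i -> Lc j -> Lc (j ∘ i).
Proof.
move=> hi hj; apply/(wfs_left hw) => A B p hp u v e.
have [|d [d1 d2]] := wfs_lifts hi hp (u := u) (v := v ∘ j).
  by rewrite e comp_assoc.
have [//|k [k1 k2]] := wfs_lifts hj hp (u := d) (v := v).
by exists k; rewrite comp_assoc k1.
Qed.

(** The retract argument: the lift [r] of [idm X] exhibits [p] as a retract of
    [q]. *)
Lemma wfs_right_retract (X Y Z : C) (p : Hom X Y) (i : Hom X Z) (q : Hom Z Y) :
  q ∘ i = p -> Rc q -> lifts i p -> Rc p.
Proof.
move=> e hq hl.
have [|r [ri pr]] := hl (idm X) q; first by rewrite comp_idr.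
apply/(wfs_right hw) => A B j hj u v euv.
have [|k [k1 k2]] := wfs_lifts hj hq (u := i ∘ u) (v := v).
  by rewrite comp_assoc e.
by exists (r ∘ k); rewrite -comp_assoc k1 !comp_assoc ri comp_idl pr.
Qed.

Lemma wfs_left_retract (X Y Z : C) (f : Hom X Y) (i : Hom X Z) (q : Hom Z Y) :
  q ∘ i = f -> Lc i -> lifts f q -> Lc f.
Proof.
move=> e hi hl.
have [|s [sf qs]] := hl i (idm Y); first by rewrite comp_idl.
apply/(wfs_left hw) => A B p hp u v euv.
have [|k [k1 k2]] := wfs_lifts hi hp (u := u) (v := v ∘ q).
  by rewrite -comp_assoc e.
by exists (k ∘ s); rewrite -comp_assoc sf comp_assoc k2 -comp_assoc qs comp_idr.
Qed.

End WeakFactorisation.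

Lemma is_wfs_ext (C : Category) (L L' R R' : MorphismClass C) :
  (forall (X Y : C) (f : Hom X Y), L X Y f <-> L' X Y f) ->
  (forall (X Y : C) (f : Hom X Y), R X Y f <-> R' X Y f) ->
  is_wfs L R -> is_wfs L' R'.
Proof.
move=> hL hR hw; split.
- move=> A B i; split.
    by move=> /hL hi X Y p /hR hp; exact: (wfs_lifts hw hi hp).
  by move=> h; apply/hL/(wfs_left hw) => X Y p /hR; apply: h.
- move=> X Y p; split.
    by move=> /hR hp A B i /hL hi; exact: (wfs_lifts hw hi hp).
  by move=> h; apply/hR/(wfs_right hw) => A B i /hL; apply: h.
- move=> X Y f; have [Z [i [p [/hL hi [/hR hp e]]]]] := wfs_fact hw f.
  by exists Z, i, p.
Qed.

(** * Initial objects of cocomplete categories *)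

Definition empty_category : Category.
Proof.
by refine (@Build_Category Empty_set (fun _ _ => unit) (fun _ => tt)
  (fun _ _ _ _ _ => tt) _ _ _); case.
Defined.

Definition empty_functor (C : Category) : Functor empty_category C.
Proof.
by refine (@Build_Functor empty_category C (fun j => match j with end)
  (fun j => match j with end) _ _); case.
Defined.

Lemma cocomplete_initial (C : Category) : cocomplete C -> inhabited (Initial C).
Proof.
move=> hc.
have hs : small_category empty_category by exists Empty_set, id; case.
have [c [leg [_ hcol]]] := hc _ (empty_functor C) hs.
have hU (X : C) : exists! h : Hom c X, True.
  have [|h [_ hu]] := hcol X (fun j => match j with end); first by case.
  by exists h; split=> // h' _; apply: hu; case.
pose b (X : C) := constructive_indefinite_description _ (hU X).
constructor; refine {| initial := c; cobang X := sval (b X) |}.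
by move=> X f g; have [h [_ hu]] := hU X; rewrite -(hu f I) (hu g I).
Qed.

(** * Weak equivalences and homotopies *)

Lemma two_of_six_three (C : Category) (W : MorphismClass C) :
  (forall X : C, W _ _ (idm X)) -> two_of_six W -> two_of_three W.
Proof.
move=> h1 h6 X Y Z f g; split; [|split] => ha hb.
- have := h6 _ _ _ _ f (idm Y) g; rewrite comp_idl comp_idr.
  by case/(_ ha hb) => _ [_ []].
- have := h6 _ _ _ _ (idm X) f g; rewrite comp_idr.
  by case/(_ ha hb) => _ [_ []].
- have := h6 _ _ _ _ f g (idm Z); rewrite comp_idl.
  by case/(_ hb ha).
Qed.

(** The constant homotopy [d] is a section of both legs, so by 2-out-of-3 the
    second leg of the path object is a weak equivalence as soon as the first one
    is. *)
Lemma weq_homotopic (C : Category) (W : MorphismClass C) (Z P X : C)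
    (d : Hom X P) (e1 e2 : Hom P X) (h : Hom Z P) :
  two_of_three W -> W _ _ (idm X) -> e1 ∘ d = idm X -> e2 ∘ d = idm X ->
  W _ _ e1 -> W _ _ (e1 ∘ h) -> W _ _ (e2 ∘ h).
Proof.
move=> h3 w1 ed1 ed2 we1 wh.
have wd : W _ _ d.
  by apply: (proj2 (proj2 (h3 _ _ _ d e1))) => //; rewrite ed1.
have we2 : W _ _ e2.
  by apply: (proj1 (proj2 (h3 _ _ _ d e2))) => //; rewrite ed2.
apply: (proj1 (h3 _ _ _ h e2)) => //.
exact: (proj2 (proj2 (h3 _ _ _ h e1))).
Qed.

(** * Pre-model categories *)

Lemma tcof_cof (C : Category) (M : PreModel C) (X Y : C) (f : Hom X Y) :
  tcof M f -> cof M f.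
Proof.
move=> hf; apply/(wfs_left (pm_wfs_cof M)) => A B p hp.
exact: (wfs_lifts (pm_wfs_fib M) hf (pm_tfib_fib hp)).
Qed.

Lemma cofibrant_replacement (C : Category) (M : PreModel C) (X : C) :
  exists (X' : C) (q : Hom X' X), cofibrant M X' /\ tfib M q.
Proof.
have [zero] := cocomplete_initial (pm_cocomplete M).
have [X' [i [q [hi [hq _]]]]] := wfs_fact (pm_wfs_cof M) (cobang zero X).
by exists X', q; split=> //; exists zero; rewrite (cobang_unique (cobang zero X') i).
Qed.

Lemma cofibrant_cof (C : Category) (M : PreModel C) (X Y : C) (i : Hom X Y) :
  cof M i -> cofibrant M X -> cofibrant M Y.
Proof.
move=> hi [zero hX]; exists zero.
rewrite (cobang_unique (cobang zero Y) (i ∘ cobang zero X)).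
exact: (wfs_left_comp (pm_wfs_cof M) hX hi).
Qed.

Lemma fibrant_fib (C : Category) (M : PreModel C) (X Y : C) (p : Hom X Y) :
  fib M p -> fibrant M Y -> fibrant M X.
Proof.
move=> hp [one hY]; exists one.
rewrite (bang_unique (bang one X) (bang one Y ∘ p)).
exact: (wfs_right_comp (pm_wfs_fib M) hp hY).
Qed.

(** The object through which [p] factors is cofibrant too, so that [p] lifts
    against the cofibration of the factorisation and the retract argument
    applies. *)
Lemma acyclic_fib_cofibrant_tfib (C : Category) (M : PreModel C) (X Y : C)
    (p : Hom X Y) : cofibrant M X -> acyclic_fib M p -> tfib M p.
Proof.
move=> hX [_ hl]; have [Z [i [q [hi [hq e]]]]] := wfs_fact (pm_wfs_cof M) p.
apply: (wfs_right_retract (pm_wfs_cof M) e hq).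
by apply: hl; split=> //; split=> //; apply: cofibrant_cof hi hX.
Qed.

(** Acyclicity tests a map against cofibrations between cofibrant objects only,
    so it gives triviality only after composition with a cofibrant replacement
    of the domain; 2-out-of-3 then removes the replacement. *)
Lemma acyclic_core_fib_weq (C : Category) (M : PreModel C) (W : MorphismClass C) :
  two_of_three W ->
  (forall (X Y : C) (f : Hom X Y), core_fib M f -> (tfib M f <-> W _ _ f)) ->
  forall (X Y : C) (p : Hom X Y),
    fibrant M X -> fibrant M Y -> acyclic_fib M p -> W _ _ p.
Proof.
move=> h3 hW X Y p fX fY [hp hl].
have [X' [q [cX' tq]]] := cofibrant_replacement M X.
have fq := pm_tfib_fib tq; have fX' := fibrant_fib fq fX.
have fpq : fib M (p ∘ q) := wfs_right_comp (pm_wfs_fib M) fq hp.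
have tpq : tfib M (p ∘ q).
  apply: acyclic_fib_cofibrant_tfib cX' _; split=> // A B i hi u v e.
  have [|d [d1 d2]] := hl _ _ _ hi (q ∘ u) v; first by rewrite comp_assoc.
  have [ci _] := hi.
  have [|k [k1 k2]] := wfs_lifts (pm_wfs_cof M) ci tq (u := u) (v := d).
    by rewrite d1.
  by exists k; rewrite -comp_assoc k2.
by apply: (proj1 (proj2 (h3 _ _ _ q p))); apply/hW.
Qed.

Lemma quillen_model_intro (C : Category) (M : PreModel C) (W : MorphismClass C) :
  two_of_three W ->
  (forall (X Y : C) (f : Hom X Y), tcof M f <-> cof M f /\ W X Y f) ->
  (forall (X Y : C) (f : Hom X Y), tfib M f <-> fib M f /\ W X Y f) ->
  quillen_model M.
Proof.
move=> h3 htc htf; exists W; split=> //; split=> //; split.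
- exact: is_wfs_ext htc (fun _ _ _ => iff_refl _) (pm_wfs_fib M).
- exact: is_wfs_ext (fun _ _ _ => iff_refl _) htf (pm_wfs_cof M).
Qed.

(** * Algebras for the fibrant replacement monad *)

Definition terminal_algebra (C : Category) (T : Monad C) (one : Terminal C) :
  Terminal (AlgCat T).
Proof.
pose t : AlgCat T := @Build_Algebra C T one (bang one _)
  (conj (bang_unique _ _) (bang_unique _ _)).
refine {| terminal := t;
          bang X := @Build_AlgHom C T X t (bang one _) (bang_unique _ _) |}.
by move=> X f g; apply: alg_hom_eq; apply: bang_unique.
Defined.

(** The structure map of an algebra is a retraction of the unit, and the free
    algebra is fibrant because the right part of a factorisation is itself an
    algebra for the monad [R]. *)
Lemma algebra_fibrant (C : Category) (M : PreModel C) (A : AWFS C)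
    (hA : algebraic_realisation A (@tcof C M) (@fib C M)) (one : Terminal C)
    (X : AlgCat (fibrant_replacement_monad one A)) :
  fib M (bang one (forget _ X)).
Proof.
apply/(proj2 hA); exists (Rfun A (to_one one (alg_ob X))); split.
- exists (Runit A (to_one one (alg_ob X))).
  exists (@Sq C (Rfun A (to_one one (alg_ob X))) (to_one one (alg_ob X))
            (alg_act X) (idm _) (bang_unique _ _)).
  apply: square_eq => /=; last exact: comp_idl.
  exact: (proj1 (alg_laws X)).
- exists (@awfs_mu C A (to_one one (alg_ob X))); split.
    exact: (monad_unitl (awfs_monad A)).
  exact: (monad_assoc (awfs_monad A)).
Qed.

(** * The transferred structure *)

Section TransferredStructure.
Context (C : Category) (M : PreModel C) (T : Monad C) (one : Terminal C)
  (N : PreModel (AlgCat T)) (hN : transferred M N)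
  (hfib : forall X : AlgCat T, fib M (bang one (forget T X)))
  (W : MorphismClass C) (W6 : two_of_six W) (W1 : forall X : C, W _ _ (idm X))
  (Wfib : forall (X Y : C) (f : Hom X Y),
    core_fib M f -> (tfib M f <-> W _ _ f)).

Definition alg_weq : MorphismClass (AlgCat T) :=
  fun X Y f => W (fmap (forget T) f).

Lemma alg_weq_two_of_three : two_of_three alg_weq.
Proof. by move=> X Y Z f g; apply: (two_of_six_three W1 W6). Qed.

Lemma transferred_tfib_iff (X Y : AlgCat T) (f : Hom X Y) :
  tfib N f <-> fib N f /\ alg_weq f.
Proof.
have core : fib N f -> core_fib M (fmap (forget T) f).
  by move=> /(proj1 hN) hf; split=> //; split; exists one.
split=> [hf|[hf hw]].
- have fN := pm_tfib_fib hf.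
  by split=> //; apply/(Wfib (core fN))/(proj2 hN).
- by apply/(proj2 hN)/(Wfib (core hf)).
Qed.

Lemma transferred_tcof_retraction (X Y : AlgCat T) (f : Hom X Y) :
  tcof N f -> exists r : Hom Y X, r ∘ f = idm X.
Proof.
move=> hf; pose t := terminal_algebra T one.
have ht : fib N (bang t X) by apply/(proj1 hN)/hfib.
have [|r [hr _]] := wfs_lifts (pm_wfs_fib N) hf ht (u := idm X) (v := bang t Y).
  exact: bang_unique.
by exists r.
Qed.

Lemma transferred_tcof_weq (X Y : AlgCat T) (f : Hom X Y) :
  path_objects_lift M T one -> tcof N f -> alg_weq f.
Proof.
move=> hpath hf; have [r rf] := transferred_tcof_retraction hf.
have [Q [P [p1 [p2 [d [p [hQ [d1 [d2 [_ [_ [_ [fp ap]]]]]]]]]]]]] := hpath Y.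
have hp : fib N p by apply/(proj1 hN).
have [k [[k1 k2] _]] := hQ Y (idm Y) (f ∘ r).
(* Both sides are the map (f, f) into the product, since f ∘ r ∘ f = f. *)
have sq : p ∘ (d ∘ f) = k ∘ f.
  have [m [_ mu]] := hQ X f f.
  rewrite -(mu (p ∘ (d ∘ f))) ?(mu (k ∘ f)) //.
    by rewrite !comp_assoc k1 k2 comp_idl -comp_assoc rf comp_idr.
  split; first by rewrite 2!comp_assoc -(comp_assoc p1) d1 comp_idl.
  by rewrite 2!comp_assoc -(comp_assoc p2) d2 comp_idl.
have [h [_ hk]] := wfs_lifts (pm_wfs_fib N) hf hp sq.
have w1 (Z : AlgCat T) : alg_weq (idm Z) by exact: W1.
have wleg : alg_weq (p1 ∘ p).
  by apply: (acyclic_core_fib_weq (two_of_six_three W1 W6) Wfib _ _ ap); exists one.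
have wfr : alg_weq (f ∘ r).
  rewrite -k2 -hk comp_assoc.
  apply: (weq_homotopic (d := d) (e1 := p1 ∘ p) alg_weq_two_of_three) => //.
  - by rewrite -comp_assoc.
  - by rewrite -comp_assoc.
  - by rewrite -comp_assoc hk k1.
have wrf : alg_weq (r ∘ f) by rewrite rf.
by case: (W6 wrf wfr).
Qed.

Lemma transferred_tcof_iff (X Y : AlgCat T) (f : Hom X Y) :
  path_objects_lift M T one -> tcof N f <-> cof N f /\ alg_weq f.
Proof.
move=> hpath; split=> [hf|[hf wf]].
  by split; [apply: tcof_cof | apply: transferred_tcof_weq].
have [Z [i [q [hi [hq e]]]]] := wfs_fact (pm_wfs_fib N) f.
apply: (wfs_left_retract (pm_wfs_fib N) e hi).
apply: (wfs_lifts (pm_wfs_cof N) hf).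
apply/transferred_tfib_iff; split=> //.
apply: (proj1 (proj2 (alg_weq_two_of_three i q))); last by rewrite e.
exact: transferred_tcof_weq.
Qed.

End TransferredStructure.

Theorem theorem30 (C : Category) (M : PreModel C)
    (hM : right_semi_model M) (hMacc : accessible_premodel M)
    (A : AWFS C) (hA : algebraic_realisation A (@tcof C M) (@fib C M))
    (hAacc : accessible_awfs A)
    (one : Terminal C)
    (N : PreModel (AlgCat (fibrant_replacement_monad one A)))
    (hNtransferred : transferred M N)
    (hNacc : accessible_premodel N) (hNweak : weak_model N)
    (hpath : path_objects_lift M (fibrant_replacement_monad one A) one) :
  quillen_model N.
Proof.
have [W [Wiso [W6 [Wfib _]]]] := hM.
have W1 (X : C) : W _ _ (idm X).
  by apply: Wiso; exists (idm X); rewrite comp_idl.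
have hfib := algebra_fibrant hA (one := one).
apply: (@quillen_model_intro _ N (alg_weq W)).
- exact: alg_weq_two_of_three.
- by move=> X Y f; apply: (transferred_tcof_iff hNtransferred hfib W6 W1 Wfib).
- by move=> X Y f; apply: (transferred_tfib_iff hNtransferred hfib Wfib).
Qed.
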